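(* (a) Let $(X,\mathcal{H})$ be a hypothesis class with $\operatorname{Ldim}(\mathcal{H})=\ell<\infty$ and $\operatorname{VC}(\mathcal{H})=d$, and let $0<\epsilon<1/2$. If $\epsilon\le\frac{1}{\ell+1}$, then $\operatorname{Ldim}(\mathcal{H}_\infty(\epsilon))=\operatorname{Ldim}(\mathcal{H})=\ell$. (b) For such $\mathcal{H}$ and $\epsilon$, if $\epsilon\le\frac{1}{d+1}$, then $\operatorname{VC}(\mathcal{H}_\infty(\epsilon))=\operatorname{VC}(\mathcal{H})=d$. (c) There is an absolute constant $C\gtrapprox 12.0412$ such that for every such $\mathcal{H}$ with $d\ge1$ and every $0<\epsilon<\frac{1}{Cd}$, $\operatorname{Ldim}(\mathcal{H}_\infty(\epsilon))<\infty$; however, $\operatorname{Ldim}(\mathcal{H}_\infty(\epsilon))$ need not equal $\operatorname{Ldim}(\mathcal{H})$, i.e. there exist such $\mathcal{H}$ and such $\epsilon<\frac1{Cd}$ with $\operatorname{Ldim}(\mathcal{H}_\infty(\epsilon))\ne\operatorname{Ldim}(\mathcal{H})$. (d) For $\epsilon>\frac{1}{d+1}$ it is possible for both dimensions of the saturation to be infinite: for every integer $d\ge 1$ and every $\epsilon$ with $\frac{1}{d+1}<\epsilon<\frac12$ there is a hypothesis class $(X,\mathcal{H})$ with $\operatorname{Ldim}(\mathcal{H})<\infty$ and $\operatorname{VC}(\mathcal{H})=d$ such that $\operatorname{Ldim}(\mathcal{H}_\infty(\epsilon))=\operatorname{VC}(\mathcal{H}_\infty(\epsilon))=\infty$.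
   Context: A hypothesis class $(X,\mathcal{H})$ is a set $X$ (finite or infinite) together with a set $\mathcal{H}$ of functions $h:X\to\{0,1\}$. For $0<\epsilon<1/2$, an $\epsilon$-hypothesis of $\mathcal{H}$ is a finite set of pairs $H=\{(h_i,\gamma_i):i<k\}$ with $h_i\in\mathcal{H}$ pairwise distinct, $\gamma_i\in(0,1]$ real, $\sum_i\gamma_i=1$, such that for every $x\in X$ there is a value $\mathbf{t}_H(x)\in\{0,1\}$ with $\sum\{\gamma_i:h_i(x)=1-\mathbf{t}_H(x)\}<\epsilon$. This defines $\mathbf{t}_H:X\to\{0,1\}$. $\epsilon$-saturation: $\mathcal{H}_0(\epsilon)=\mathcal{H}$; $\mathcal{H}_{n+1}(\epsilon)=\mathcal{H}_n(\epsilon)\cup\{\mathbf{t}_H: H\text{ is an }\epsilon\text{-hypothesis of }\mathcal{H}_n(\epsilon)\}$ (as a set of functions on $X$); $\mathcal{H}_\infty(\epsilon)=\bigcup_{n<\omega}\mathcal{H}_n(\epsilon)$. $\operatorname{Ldim}(\mathcal{H})$ is the Littlestone dimension: the greatest $m$ (or $\infty$ if there is no greatest) for which there is a full binary tree of height $m$ with internal nodes labelled by elements of $X$ such that every branch $\langle(x_i,y_i):1\le i\le m\rangle$ ($x_i$ the $i$-th node label, $y_i=1$ for going right and $0$ for left) is realized by some $h\in\mathcal{H}$, i.e. $h(x_i)=y_i$ for all $i$. $\operatorname{VC}(\mathcal{H})$ is the Vapnik–Chervonenkis dimension. *)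

(* Defs.v *)
From HB Require Import structures.
From mathcomp Require Import all_boot all_order all_algebra.
From mathcomp Require Import boolp classical_sets reals.

Set Implicit Arguments.
Unset Strict Implicit.
Unset Printing Implicit Defensive.

Import Order.TTheory GRing.Theory Num.Theory.
Local Open Scope ring_scope.

(* Dimensions take values in [option nat]; [infty] is the infinite value. *)
Notation infty := (@None nat).

(* The greatest element of P, or [infty] if there is none.  For the dimensions
   below, P is an initial segment of nat, nonempty as soon as the class is, so
   [infty] then means that P is all of nat.  The empty class realizes not even
   the tree of height 0, so it also gets the value [infty]. *)
Definition greatest (P : nat -> Prop) : option nat :=
  if pselect (exists m, P m /\ forall n, P n -> (n <= m)%N) is left e
  then Some (projT1 (cid e)) else infty.

Lemma greatestP (P : nat -> Prop) (m : nat) :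
  greatest P = Some m <-> P m /\ forall n, P n -> (n <= m)%N.
Proof.
rewrite /greatest; case: pselect => [e|ne]; last first.
  by split=> // Pm; case: ne; exists m.
case: (cid e) => k [Pk kmax] /=; split=> [[<-] //|[Pm mmax]].
by congr Some; apply/eqP; rewrite eqn_leq mmax // kmax.
Qed.

Section Dimensions.
Variables (X : Type) (H : set (X -> bool)).

Inductive tree : Type := Leaf | Node of X & tree & tree.

Fixpoint full (m : nat) (t : tree) : Prop :=
  match m, t with
  | 0%N, Leaf => True
  | m'.+1, Node _ l r => full m' l /\ full m' r
  | _, _ => False
  end.

(* The pairs (x_i, y_i) along the branch of t given by the directions y
   ([true] is right, [false] is left). *)
Fixpoint branch (t : tree) (y : seq bool) : seq (X * bool) :=
  match t, y with
  | Node x l r, b :: y' => (x, b) :: branch (if b then r else l) y'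
  | _, _ => [::]
  end.

Definition realizes (h : X -> bool) (s : seq (X * bool)) : bool :=
  all (fun p => h p.1 == p.2) s.

Definition littlestone_shatters (m : nat) : Prop :=
  exists t : tree, full m t /\
    forall y : seq bool, size y = m -> exists2 h, H h & realizes h (branch t y).

Definition Ldim : option nat := greatest littlestone_shatters.

Definition VC_shatters (m : nat) : Prop :=
  exists x : 'I_m -> X, injective x /\
    forall y : 'I_m -> bool, exists2 h, H h & forall i, h (x i) = y i.

Definition VC : option nat := greatest VC_shatters.

End Dimensions.

Section Saturation.
Variables (R : realType) (X : Type).

(* A finite family (h_i, gamma_i), i < k. *)
Record weighted_family := WeightedFamily {
  wf_size : nat;
  wf_fun : 'I_wf_size -> X -> bool;
  wf_weight : 'I_wf_size -> R }.

(* The total weight of the h_i with h_i(x) = 1 - b. *)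
Definition disagreement (F : weighted_family) (x : X) (b : bool) : R :=
  \sum_(i < wf_size F | wf_fun i x == ~~ b) wf_weight i.

Definition eps_hypothesis (H : set (X -> bool)) (eps : R)
    (F : weighted_family) : Prop :=
  [/\ forall i, H (@wf_fun F i),
      injective (@wf_fun F),
      forall i, 0 < @wf_weight F i <= 1,
      \sum_(i < wf_size F) wf_weight i = 1
    & forall x, exists b, disagreement F x b < eps].

(* [t] is the function t_F; it is unique when eps < 1/2, see
   [is_threshold_unique]. *)
Definition is_threshold (eps : R) (F : weighted_family) (t : X -> bool) : Prop :=
  forall x, disagreement F x (t x) < eps.

Lemma is_threshold_unique (H : set (X -> bool)) (eps : R) F t t' :
  eps < 1 / 2 -> eps_hypothesis H eps F ->
  is_threshold eps F t -> is_threshold eps F t' -> t = t'.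
Proof.
move=> eps2 [_ _ _ sum1 _] Ht Ht'; apply/funext => x.
have sumE b : disagreement F x b + disagreement F x (~~ b) = 1.
  rewrite -sum1 (bigID (fun i => wf_fun i x == ~~ b)) /=; congr (_ + _).
  by apply: eq_bigl => i; case: b; case: (wf_fun i x).
apply/eqP; apply/negPn/negP => neq.
have t'E : t' x = ~~ t x by case: (t x) (t' x) neq => [] [].
have := ltrD (lt_trans (Ht x) eps2) (lt_trans (Ht' x) eps2).
by rewrite t'E sumE -splitr ltxx.
Qed.

Fixpoint saturation (H : set (X -> bool)) (eps : R) (n : nat)
    : set (X -> bool) :=
  if n is n'.+1 then
    (saturation H eps n' `|`
     [set t | exists2 F, eps_hypothesis (saturation H eps n') eps F
                       & is_threshold eps F t])%classic
  else H.

Definition saturation_infty (H : set (X -> bool)) (eps : R) : set (X -> bool) :=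
  (\bigcup_n saturation H eps n)%classic.

End Saturation.

(* Main.v *)
Require Import Defs.
From HB Require Import structures.
From mathcomp Require Import all_boot all_order all_algebra.
From mathcomp Require Import boolp classical_sets reals.
From mathcomp Require Import zify lra.

(** Everything positive rests on one union bound.  If t is the threshold of an
    eps-hypothesis F, then at each point less than eps of the weight of F
    disagrees with t; so on k points with k * eps <= 1 the total weight that errs
    somewhere is less than 1, and some member of F agrees with t on all k points.
    By induction on the saturation steps, every function of the full saturation
    agrees with some member of H on any k such points ([saturation_agree]).
    A shattered set of d + 1 points, or one branch of a shattered tree of height
    l + 1, only tests that many points: hence (a) and (b).

    For the finiteness in (c), the agreement holds on 2(d + 1) <= 4 d <= 1 / eps
    points, which is too few to carry a tall tree over to H.  Suppose that the
    saturation shatters very tall trees.  Then it contains long threshold chains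
    g_i (x_j) = [j < i], up to negation ([littlestone_threshold_chain]).  Put
    m = d + 1.  For every set S of 2m indices, H has a member h_S that agrees on
    S with the threshold function cutting S in the middle.  By Ramsey's theorem
    for (2m + 1)-sets of indices one may assume that, for q outside S, the value
    h_S (x_q) depends only on the number of elements of S below q; call it v_j for
    j such elements ([rank_function]).  If v_j differs from v_(j+1), moving one
    element of S produces long threshold chains inside H, which therefore
    shatters tall trees by binary search.  If v is constant, then h_S singles out
    exactly the lower half or exactly the upper half of S, and varying S realizes
    every pattern on m points ([rank_dichotomy]).  Both are impossible when
    VC H = d and Ldim H is finite.

    The examples come from one observation: a finite set with n distinguished
    points is the threshold of its n one-point deletions with equal weights, as
    soon as 1 / n < eps ([saturation_deletions]).  For (d), the sets of at most d
    naturals saturate to all finite sets.  For the second half of (c), one takes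
    the chains of nonempty prefixes of the words of length m, with one point
    deleted.  These sets have m - 1 elements, so that they shatter no tree of
    height m, and their VC dimension is at most 2 whatever m is, while the whole
    chains shatter a tree of height m. *)

Set Implicit Arguments.
Unset Strict Implicit.
Unset Printing Implicit Defensive.

Import Order.TTheory GRing.Theory Num.Theory.
Local Open Scope ring_scope.

(** * Shattered trees and shattered sets *)

Lemma greatest_bounded (P : nat -> Prop) (n N : nat) :
  P n -> (forall m, P m -> (m <= N)%N) ->
  exists2 m, greatest P = Some m & (n <= m <= N)%N.
Proof.
move=> Pn bnd.
have ex : exists k, `[<P k>] by exists n; apply/asboolP.
have ub k : `[<P k>] -> (k <= N)%N by move/asboolP/bnd.
case: (ex_maxnP ex ub) => m /asboolP Pm mmax; exists m.
  by apply/greatestP; split=> // k Pk; apply: mmax; apply/asboolP.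
by rewrite bnd // mmax //; apply/asboolP.
Qed.

Lemma greatest_infty (P : nat -> Prop) : (forall m, P m) -> greatest P = infty.
Proof.
case E: (greatest P) => [m|//] Pall.
by have /greatestP[_ /(_ _ (Pall m.+1))] := E; rewrite ltnn.
Qed.

(** Littlestone shattering by recursion on the class instead of on a labelled
    tree: the root label cuts the class in two parts, each of which must split to
    depth m - 1.  The set P constrains the labels, so that one can speak of
    subtrees all of whose labels have a common property. *)
Fixpoint splits (X : Type) (P : set X) (m : nat) (G : set (X -> bool)) : Prop :=
  if m is m'.+1 then
    exists2 x, P x & forall b, splits P m' [set g | G g /\ g x = b]%classic
  else exists g, G g.

Lemma splits_sub (X : Type) (P P' : set X) m (G G' : set (X -> bool)) :
  (forall x, P x -> P' x) -> (forall g, G g -> G' g) ->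
  splits P m G -> splits P' m G'.
Proof.
move=> PP'; elim: m G G' => [|m IH] G G' GG' /=; first by move=> [g /GG']; exists g.
move=> [x /PP' Px spl]; exists x => // b.
by apply: IH (spl b) => g /= [/GG'].
Qed.

Lemma splits_le (X : Type) (P : set X) m n (G : set (X -> bool)) :
  (m <= n)%N -> splits P n G -> splits P m G.
Proof.
move/subnK <-; elim: (n - m)%N => [//|k IH]; rewrite addSn => -[x _ /(_ true) spl].
by apply: IH; apply: splits_sub spl => // g [].
Qed.

Lemma littlestone_splits (X : Type) m (G : set (X -> bool)) :
  littlestone_shatters G m <-> splits setT m G.
Proof.
elim: m G => [|m IH] G; split.
- by move=> [t [_ /(_ [::] erefl) [g Gg _]]]; exists g.
- by move=> [g Gg]; exists (Leaf X); split=> // -[|//] _; exists g.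
- move=> [t [ft real]]; case: t ft real => [//|x l r] [fl fr] real.
  exists x => // b; apply/IH.
  exists (if b then r else l); split=> [|y sy]; first by case: b.
  by have [|h Hh /andP[/eqP hx hy]] := real (b :: y); [rewrite /= sy|exists h].
- move=> [x _ spl].
  have /IH[r [fr realr]] := spl true; have /IH[l [fl reall]] := spl false.
  exists (Node x l r); split=> // -[|b y] //= [sy].
  have [h [Gh hx] hy] : exists2 h, G h /\ h x = b
      & realizes h (branch (if b then r else l) y).
    by case: b => /=; [exact: realr|exact: reall].
  by exists h => //=; rewrite hx eqxx.
Qed.

Lemma littlestone_le (X : Type) m n (G : set (X -> bool)) :
  (m <= n)%N -> littlestone_shatters G n -> littlestone_shatters G m.
Proof. by move=> mn /littlestone_splits/(splits_le mn)/littlestone_splits. Qed.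

(** Injectivity of the points comes for free: two equal points cannot receive
    the pattern that is true at exactly one of them. *)
Lemma VC_shattersP (X : Type) m (G : set (X -> bool)) (x : 'I_m -> X) :
  (forall y : 'I_m -> bool, exists2 h, G h & forall i, h (x i) = y i) ->
  VC_shatters G m.
Proof.
move=> real; exists x; split=> // i j xij.
have [h _ hE] := real (fun k => k == j).
by have := hE i; rewrite xij hE eqxx => /esym/eqP.
Qed.

Lemma VC_shatters_le (X : Type) m n (G : set (X -> bool)) :
  (m <= n)%N -> VC_shatters G n -> VC_shatters G m.
Proof.
move=> mn [x [_ real]]; apply: (@VC_shattersP _ _ _ (x \o widen_ord mn)) => y.
have [h Gh hE] := real (fun i => if insub (val i) is Some j then y j else false).
by exists h => // i /=; rewrite hE /= valK.
Qed.

(** The tree has the same label at all nodes of a given level. *)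
Lemma VC_littlestone (X : Type) m (G : set (X -> bool)) :
  VC_shatters G m -> littlestone_shatters G m.
Proof.
move=> [x [_ real]]; apply/littlestone_splits.
elim: m G x real => [|m IH] G x real /=.
  by have [h Gh _] := real (fun=> true); exists h.
exists (x ord0) => // b; apply: (IH _ (fun i => x (lift ord0 i))) => y.
have [h Gh hE] := real (fun i => if unlift ord0 i is Some j then y j else b).
exists h; first by split=> //; rewrite hE unlift_none.
by move=> i; rewrite hE liftK.
Qed.

(** The branch that always goes right ends in a function that is true at all m
    labels of this branch, and these labels are distinct: a repeated label would
    make the left turn at its second occurrence unrealizable.  The sequence u of
    the proof collects the labels met so far. *)
Lemma splits_support (X : eqType) (P : set X) m k (G : set (X -> bool)) :
  (forall g, G g -> exists2 s : seq X, (size s <= k)%N & forall x, g x -> x \in s) ->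
  splits P m G -> (m <= k)%N.
Proof.
suff main: forall (u : seq X), uniq u ->
    (forall g x, G g -> x \in u -> g x) -> splits P m G ->
    exists2 g, G g & exists2 s, uniq s /\ size s = (size u + m)%N
        & forall x, x \in s -> g x.
  move=> supp /(main [::] isT)[//|g Gg [s [us sz] sg]].
  have [s' ss' gs'] := supp g Gg; rewrite -[m]add0n -sz (leq_trans _ ss') //.
  by apply: uniq_leq_size => // x /sg /gs'.
elim: m G => [|m IH] G u uu Gu /=.
  by move=> [g Gg]; exists g => //; exists u => [|x xu]; [rewrite addn0|apply: Gu].
move=> [x Px spl].
have xu : x \notin u.
  apply/negP => xu.
  have [g [Gg gx]] : exists g, G g /\ g x = false.
    by case: (splits_le (leq0n m) (spl false)) => g; exists g.
  by rewrite (Gu g x) in gx.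
have [||g [Gg _] [s [us sz] sg]] := IH _ (x :: u) _ _ (spl true).
- by rewrite /= xu.
- by move=> g z [Gg gx]; rewrite inE => /orP[/eqP->|/Gu->].
by exists g => //; exists s => //; split=> //; rewrite sz /= addSnnS.
Qed.

Lemma littlestone_support (X : eqType) m k (G : set (X -> bool)) :
  (forall g, G g -> exists2 s : seq X, (size s <= k)%N & forall x, g x -> x \in s) ->
  littlestone_shatters G m -> (m <= k)%N.
Proof. by move=> supp /littlestone_splits; apply: splits_support. Qed.


(** * Local agreement of the saturation with the class *)

Lemma map_eq_hasN (X : Type) (h t : X -> bool) (s : seq X) :
  ~~ has (fun x => h x == ~~ t x) s -> map h s = map t s.
Proof.
elim: s => //= x s IH; rewrite negb_or => /andP[hx /IH->]; congr cons.
by move: hx; case: (h x) (t x) => [] [].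
Qed.

(** The union bound: if no member of an eps-hypothesis agreed with its threshold
    on all of s, each would be counted in the disagreement at some point of s, so
    the disagreements would add up to at least 1, against size s * eps <= 1. *)
Lemma saturation_agree (R : realType) (X : Type) (H : set (X -> bool)) (eps : R)
    (t : X -> bool) (s : seq X) :
  (size s)%:R * eps <= 1 -> saturation_infty H eps t ->
  exists2 h, H h & map h s = map t s.
Proof.
move=> seps [n _]; elim: n t => [|n IH] t; first by exists t.
case=> [/IH //|[F [HF _ wF sumF _] Ft]].
suff [i agr] : exists i, map (@wf_fun _ _ F i) s = map t s.
  by have [h Hh hF] := IH _ (HF i); exists h => //; rewrite hF.
apply/not_existsP => nagr.
have cover : 1 <= \sum_(x <- s) disagreement F x (t x).
  rewrite -sumF /disagreement (exchange_big_dep xpredT) //=.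
  apply: ler_sum => i _; have [wi _] := andP (wF i).
  have : has (fun x => wf_fun i x == ~~ t x) s.
    by apply/negP => /negP/map_eq_hasN; apply: nagr.
  elim: s {nagr seps IH} => //= x s IHs; rewrite big_cons.
  have rest (r : seq X) : 0 <= \sum_(j <- r | wf_fun i j == ~~ t j) wf_weight i.
    by apply: sumr_ge0 => *; apply: ltW.
  by case: ifP => [_ _|_ /IHs//]; rewrite lerDl.
case: s seps cover {nagr IH} => [|x s] seps; first by rewrite big_nil ler10.
(* One point of s is enough to make the bound strict. *)
rewrite big_cons leNgt => /negP; apply; apply: lt_le_trans seps.
rewrite /= -add1n natrD mulrDl mul1r ltr_leD //.
elim: s => [|y s IHs]; first by rewrite big_nil mul0r.
by rewrite big_cons /= -add1n natrD mulrDl mul1r lerD // ltW.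
Qed.

Lemma sub_saturation (R : realType) (X : Type) (H : set (X -> bool)) (eps : R) h :
  H h -> saturation_infty H eps h.
Proof. by move=> Hh; exists 0%N. Qed.

(** Shattering m points, or a tree of height m, only tests functions on m points
    at a time, so it passes from G to any H that agrees with G on m points at a
    time. *)
Lemma VC_agree (X : Type) m (G H : set (X -> bool)) :
  (forall s t, size s = m -> G t -> exists2 h, H h & map h s = map t s) ->
  VC_shatters G m -> VC_shatters H m.
Proof.
move=> agr [x [_ real]]; apply: (@VC_shattersP _ _ _ x) => y.
have [g Gg gE] := real y.
have [|h Hh hg] := agr (map x (enum 'I_m)) g _ Gg; first by rewrite size_map size_enum_ord.
exists h => // i; rewrite -gE.
move: hg; rewrite -[LHS]map_comp -[RHS]map_comp => /eq_in_map; apply.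
by rewrite mem_enum.
Qed.

Lemma size_branch (X : Type) (t : tree X) y : full (size y) t -> size (branch t y) = size y.
Proof. by elim: y t => [|b y IH] [|x l r] //= [fl fr]; rewrite IH //; case: b. Qed.

Lemma littlestone_agree (X : Type) m (G H : set (X -> bool)) :
  (forall s t, size s = m -> G t -> exists2 h, H h & map h s = map t s) ->
  littlestone_shatters G m -> littlestone_shatters H m.
Proof.
move=> agr [t [ft real]]; exists t; split=> // y sy.
have [g Gg gy] := real y sy.
have [|h Hh hg] := agr (unzip1 (branch t y)) g _ Gg.
  by rewrite size_map size_branch sy.
have realE f : realizes f (branch t y) = (map f (unzip1 (branch t y)) == unzip2 (branch t y)).
  by elim: (branch t y) => //= p s IHs; rewrite IHs -eqseq_cons.
by exists h => //; rewrite realE hg -realE.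
Qed.

Lemma littlestone_sub (X : Type) m (G G' : set (X -> bool)) :
  (forall g, G g -> G' g) -> littlestone_shatters G m -> littlestone_shatters G' m.
Proof.
by move=> GG' [t [ft real]]; exists t; split=> // y /real[h /GG']; exists h.
Qed.

Lemma VC_sub (X : Type) m (G G' : set (X -> bool)) :
  (forall g, G g -> G' g) -> VC_shatters G m -> VC_shatters G' m.
Proof.
by move=> GG' [x [ix real]]; exists x; split=> // y; have [h /GG'] := real y; exists h.
Qed.

Lemma greatest_saturation (P P' : nat -> Prop) k :
  greatest P = Some k -> (forall n, P n -> P' n) ->
  (forall m n, (m <= n)%N -> P' n -> P' m) ->
  (P' k.+1 -> P k.+1) -> greatest P' = Some k.
Proof.
move=> /greatestP[Pk kmax] PP' P'le back; apply/greatestP; split=> [|n P'n]; first exact: PP'.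
rewrite leqNgt; apply/negP => /P'le /(_ P'n) /back /kmax.
by rewrite ltnn.
Qed.

Lemma Ldim_saturation (R : realType) (X : Type) (H : set (X -> bool)) l (eps : R) :
  Ldim H = Some l -> eps <= 1 / (l + 1)%:R -> Ldim (saturation_infty H eps) = Some l.
Proof.
move=> Hl eps_le; apply: greatest_saturation Hl _ _ _.
- by move=> n; apply/littlestone_sub/sub_saturation.
- by move=> m n; apply: littlestone_le.
- apply: littlestone_agree => s t sz; apply: saturation_agree.
  by rewrite sz mulrC -ler_pdivlMr ?ltr0n // -addn1.
Qed.

Lemma VC_saturation (R : realType) (X : Type) (H : set (X -> bool)) d (eps : R) :
  VC H = Some d -> eps <= 1 / (d + 1)%:R -> VC (saturation_infty H eps) = Some d.
Proof.
move=> Hd eps_le; apply: greatest_saturation Hd _ _ _.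
- by move=> n; apply/VC_sub/sub_saturation.
- by move=> m n; apply: VC_shatters_le.
- apply: VC_agree => s t sz; apply: saturation_agree.
  by rewrite sz mulrC -ler_pdivlMr ?ltr0n // -addn1.
Qed.

(** * Ramsey's theorem *)

Lemma pigeonhole (T : Type) (C : finType) (f : T -> C) (M : nat) (s : seq T) :
  (0 < #|C|)%N -> (M * #|C| <= size s)%N ->
  exists c, (M <= count (fun x => f x == c) s)%N.
Proof.
move=> C0 sM; apply/not_existsP => few.
have sumE : (\sum_c count (fun x => f x == c) s = size s)%N.
  rewrite -sum1_size; under eq_bigr => c _ do rewrite -sum1_count.
  rewrite (exchange_big_dep xpredT) //=; apply: eq_bigr => x _.
  by rewrite (eq_bigl (pred1 (f x))) ?big_pred1_eq // => c; rewrite eq_sym.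
move: sM; rewrite -sumE leqNgt => /negP; apply.
have lt c : (count (fun x => f x == c) s < M)%N.
  by rewrite ltnNge; apply/negP => ?; apply: (few c).
case: M lt {few} => [|M] lt; first by have /card_gt0P[c _] := C0; have := lt c.
apply: (@leq_ltn_trans (\sum_(c : C) M)%N); first by apply: leq_sum => c _; apply: lt.
by rewrite sum_nat_const mulnC ltn_mul2r C0 ltnSn.
Qed.

(** More than two colours are used later, where one colour records several boolean
    values at once.  The proof is classical: [end_hom] extracts a subsequence on
    which the colour depends only on the first element, using the theorem for r at
    each step, and the pigeonhole principle then makes that dependence constant. *)
Lemma ramsey (T : eqType) (C : finType) r M :
  exists N, forall (col : seq T -> C) (s : seq T), (N <= size s)%N ->
    exists s' c, [/\ subseq s' s, size s' = M
      & forall t, subseq t s' -> size t = r -> col t = c].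
Proof.
elim: r M => [|r IHr] M.
  exists M => col s Ms; exists (take M s), (col [::]); split.
  - exact: take_subseq.
  - by rewrite size_takel.
  - by move=> [].
have end_hom p : exists N, forall (col : seq T -> C) (s : seq T), (N <= size s)%N ->
    exists s' (f : T -> C), [/\ subseq s' s, size s' = p
      & forall x t, subseq (x :: t) s' -> size t = r -> col (x :: t) = f x].
  elim: p => [|p [N1 IHp]].
    by exists 0%N => col s _; exists [::], (fun=> col [::]); rewrite sub0seq.
  have [N2 N2P] := IHr N1; exists N2.+1 => col [//|x s] sN.
  have [s1 [c [s1s s1N s1c]]] := N2P (fun t => col (x :: t)) s sN.
  have [|s2 [f [s2s1 s2p s2f]]] := IHp col s1; first by rewrite s1N.
  exists (x :: s2), (fun y => if y == x then c else f y); split=> [||y t].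
  - by rewrite /= eqxx (subseq_trans s2s1).
  - by rewrite /= s2p.
  - rewrite /=; case: eqP => [-> ts2|_]; last exact: s2f.
    by apply: s1c; apply: subseq_trans s2s1.
have [N NP] := end_hom (M * #|C|)%N; exists N => col s /(NP col)[s1 [f [s1s s1M s1f]]].
have C0 : (0 < #|C|)%N by apply/card_gt0P; exists (col [::]).
have [|c cM] := @pigeonhole _ _ f M s1 C0; first by rewrite s1M.
pose s2 := [seq x <- s1 | f x == c].
have s2s1 : subseq (take M s2) s1 := subseq_trans (take_subseq _ _) (filter_subseq _ _).
exists (take M s2), c; split=> [||[//|x t] ts2 [tr]].
- exact: subseq_trans s1s.
- by rewrite size_takel // size_filter.
- rewrite s1f ?(subseq_trans ts2) //; apply/eqP.
  have : x \in s2 by apply: mem_take; apply: (mem_subseq ts2); apply: mem_head.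
  by rewrite mem_filter => /andP[].
Qed.

(** * Threshold chains and trees *)

(** A Ramsey property of trees.  If the colour q of the root is true, then either
    both halves contain a subtree of height m - 1 with labels of this colour, and
    the root completes it to height m, or one half already contains a subtree of
    height n with labels of the other colour; symmetrically if q is false. *)
Lemma splits_color (X : Type) (P : set X) (q : X -> bool) m n (G : set (X -> bool)) :
  splits P (m + n) G ->
  splits [set x | P x /\ q x = true]%classic m G \/
  splits [set x | P x /\ q x = false]%classic n G.
Proof.
move: {-1}(m + n)%N (erefl (m + n)%N) => k; elim: k m n G => [|k IH] [|m] n G //.
- by move=> _ [g Gg]; left; exists g.
- by move=> E /(splits_le (leq0n _)) [g Gg]; left; exists g.
case: n => [|n] E; first by move/(splits_le (leq0n _)) => [g Gg]; right; exists g.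
move=> [x Px spl].
have weaken b k' (P' : set X) : splits P' k' [set g | G g /\ g x = b]%classic -> splits P' k' G.
  by apply: splits_sub => // g [].
case qx: (q x).
- have side b := IH m n.+1 _ ltac:(lia) (spl b).
  case: (side true) => [st|/weaken]; last by right.
  case: (side false) => [sf|/weaken]; last by right.
  by left; exists x => // -[].
- have side b := IH m.+1 n _ ltac:(lia) (spl b).
  case: (side true) => [/weaken|st]; first by left.
  case: (side false) => [/weaken|sf]; first by left.
  by right; exists x => // -[].
Qed.

Definition threshold_chain (X : Type) (b : bool) (n : nat)
    (g : nat -> X -> bool) (x : nat -> X) : Prop :=
  forall i j, (i < n)%N -> (j < n)%N -> g i (x j) = b (+) (j < i)%N.

(** The chain is built from the front.  Fix g0 in G and colour the labels by g0; a
    tall subtree has all its labels of one colour c.  Its root x0 and the part of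
    G that takes the value ~~ c at x0 are such that g0 takes the value c at all
    further points and all further functions take the value ~~ c at x0.  The
    polarity c may vary from step to step; the two targets p and q, one for each
    polarity, take care of the pigeonhole argument. *)
Lemma splits_threshold_chain (X : Type) k :
  exists N, forall (P : set X) (G : set (X -> bool)) p q,
  (p + q = k)%N -> splits P N.+1 G ->
  exists b g x, [/\ threshold_chain b (if b then p else q) g x,
    forall i, (i < if b then p else q)%N -> G (g i)
    & forall i, (i < if b then p else q)%N -> P (x i)].
Proof.
elim: k => [|k [N IH]].
  exists 0%N => P G p q pq [x Px /(_ true) [g [Gg _]]].
  have [-> ->] : p = 0%N /\ q = 0%N by lia.
  by exists true, (fun=> g), (fun=> x).
exists (N.+2 + N.+1)%N => P G p q pq; rewrite -addnS => spl.
have [g0 Gg0] := splits_le (leq0n _) spl.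
have {spl} [c spl] : exists c, splits [set x | P x /\ g0 x = c]%classic N.+2 G.
  by case: (splits_color g0 spl) => ?; [exists true|exists false].
have [x0 [Px0 g0x0] /(_ (~~ c)) {}spl] := spl.
have [done|todo] := posnP (if c then p else q).
  by exists c, (fun=> g0), (fun=> x0); split=> [i j||]; rewrite done.
have [b [g [x [thr Gg Px]]]] := IH _ _ (if c then p.-1 else p) (if c then q else q.-1)
  ltac:(by case: (c) todo; lia) spl.
have [bc|bc] := eqVneq b c; last first.
  (* The step had the other polarity, so it is dropped from the chain. *)
  have nE : (if b then if c then p.-1 else p else if c then q else q.-1) = if b then p else q.
    by case: b c bc {todo thr Gg Px spl g0x0} => [] [].
  rewrite nE in thr Gg Px; exists b, g, x; split=> // i.
  - by move=> /Gg[].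
  - by move=> /Px[].
exists c, (fun i => if i is i'.+1 then g i' else g0), (fun i => if i is i'.+1 then x i' else x0).
move: thr Gg Px todo; rewrite bc.
have -> : (if c then if c then p.-1 else p else if c then q else q.-1) = (if c then p else q).-1.
  by case: (c).
move: (if c then p else q) => n thr Gg Px n0.
split.
- move=> [|i] [|j] iN jN.
  + by rewrite g0x0 addbF.
  + by have [|_ ->] := Px j; [lia|rewrite addbF].
  + by have [|_ ->] := Gg i; [lia|rewrite addbT].
  + by rewrite thr //; lia.
- by move=> [|i] iN //; have [|] := Gg i; first lia.
- by move=> [|i] iN //; have [|] := Px i; first lia.
Qed.

Lemma littlestone_threshold_chain (X : Type) n : exists N, forall G : set (X -> bool),
  littlestone_shatters G N ->
  exists b g x, threshold_chain b n g x /\ forall i, (i < n)%N -> G (g i).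
Proof.
have [N NP] := splits_threshold_chain X (n + n); exists N.+1 => G /littlestone_splits spl.
have [b [g [x [thr Gg _]]]] := NP _ _ n n erefl spl.
by rewrite if_same in thr Gg; exists b, g, x.
Qed.

(** Binary search.  The value of h p at x p is left free, because later the
    functions come from sets that contain their own index. *)
Lemma threshold_littlestone (X : Type) k : exists n, forall (H : set (X -> bool)) h x u,
  (forall p, (p < n)%N -> H (h p)) ->
  (forall p q, (p < n)%N -> (q < n)%N -> p != q -> h p (x q) = u (+) (p < q)%N) ->
  littlestone_shatters H k.
Proof.
suff [n nP] : exists n, forall (H : set (X -> bool)) (h : nat -> X -> bool) x u,
    (forall p, (p < n)%N -> H (h p)) ->
    (forall p q, (p < n)%N -> (q < n)%N -> p != q -> h p (x q) = u (+) (p < q)%N) ->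
    splits setT k H.
  by exists n => H h x u Hh hx; apply/littlestone_splits/nP; eassumption.
elim: k => [|k [n IH]].
  by exists 1%N => H h x u Hh _; exists (h 0%N); apply: Hh.
exists (n + n.+1)%N => H h x u Hh hx; exists (x n) => // b.
(* The functions that take the value b at x n are those before n or those
   after n; s is the offset of the corresponding half. *)
pose s := if b == u then n.+1 else 0%N.
apply: (IH _ (fun p => h (s + p)%N) (fun q => x (s + q)%N) u).
- move=> p pn; split; first by apply: Hh; rewrite /s; case: ifP; lia.
  by rewrite hx; rewrite /s; try case: ifP; lia.
- move=> p q pn qn pq; rewrite hx ?ltn_add2l ?eqn_add2l //.
  + by rewrite /s; case: ifP; lia.
  + by rewrite /s; case: ifP; lia.
Qed.

(** * Classes that agree locally with long threshold chains *)

Lemma sorted_ltn_subseq (s t : seq nat) :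
  sorted ltn s -> sorted ltn t -> {subset s <= t} -> subseq s t.
Proof.
move=> ss st sub; suff -> : s = [seq z <- t | z \in s] by apply: filter_subseq.
apply: (irr_sorted_eq ltn_trans ltnn) => //; first exact: sorted_filter ltn_trans _ _ st.
by move=> z; rewrite mem_filter andb_idr //; apply: sub.
Qed.

Lemma index_sorted_ltn (s : seq nat) q :
  sorted ltn s -> q \in s -> index q s = count (fun z => (z < q)%N) s.
Proof.
elim: s => //= z s IH pz; rewrite inE eq_sym => qs.
have zs : all (ltn z) s by apply: order_path_min pz; apply: ltn_trans.
have [zq|zq] := eqVneq z q; last first.
  have {}qs : q \in s by move: qs; rewrite (negPf zq).
  have zlq : (z < q)%N := allP zs _ qs.
  by rewrite zlq add1n IH ?(path_sorted pz).
rewrite zq ltnn /= add0n; apply/esym/eqP; rewrite -leqn0 leqNgt -has_count.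
by apply/hasPn => u /(allP zs) /=; rewrite zq -leqNgt => /ltnW.
Qed.

(** Sorted sequences stand for sets of indices, and the number of elements of s
    below q for the rank of q in s.  On s itself, h s is the threshold function
    that cuts s in the middle; Ramsey's theorem gives v: the pair formed by s and
    a point q outside it is encoded by the set t of size M + 1 obtained by adding
    q to s, together with the position of q in t, and the colour of t records the values
    for all positions at once. *)
Lemma rank_function (X : Type) (H : set (X -> bool)) (G : set (X -> bool)) (m n : nat) :
  (forall s t, size s = (m.+1 + m.+1)%N -> G t -> exists2 h, H h & map h s = map t s) ->
  exists N, littlestone_shatters G N ->
  exists b (v : nat -> bool) (h : seq nat -> X -> bool) (x : nat -> X),
  forall s, sorted ltn s -> all (ltn^~ n) s -> size s = (m.+1 + m.+1)%N ->
    H (h s) /\ forall q, (q < n)%N ->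
      h s (x q) = if q \in s then b (+) (count (ltn^~ q) s < m.+1)%N
                  else v (count (ltn^~ q) s).
Proof.
set M := (m.+1 + m.+1)%N => agr.
have [N0 N0P] := ramsey nat {ffun 'I_M.+1 -> bool} M.+1 n.
have [N NP] := littlestone_threshold_chain X N0; exists N => /NP[b [g [x [thr Gg]]]].
have /choice[h hP] : forall s : seq nat, exists f, sorted ltn s -> all (ltn^~ N0) s ->
    size s = M -> H f /\ forall k, (k < M)%N -> f (x (nth 0%N s k)) = b (+) (k < m.+1)%N.
  move=> s; have [[ss sN sM]|bad] := pselect [/\ sorted ltn s, all (ltn^~ N0) s & size s = M];
    last by exists (fun=> true) => *; case: bad.
  have mM : (m.+1 < M)%N by rewrite /M; lia.
  have sN0 k : (k < M)%N -> (nth 0%N s k < N0)%N.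
    by rewrite -sM => ks; apply: (allP sN); apply: mem_nth.
  have [|f Hf fE] := agr (map x s) (g (nth 0%N s m.+1)) _ (Gg _ (sN0 _ mM)).
    by rewrite size_map.
  exists f => _ _ _; split=> // k kM.
  have := congr1 (fun r => nth true r k) fE; rewrite -!map_comp /=.
  rewrite !(nth_map 0%N) ?sM //= => ->; rewrite thr ?sN0 //; congr (_ (+) _).
  have mono := sorted_ltn_nth ltn_trans 0%N ss.
  have [km|mk|->] := ltngtP k m.+1.
  - by apply: mono => //; rewrite inE sM.
  - apply/negbTE; rewrite -leqNgt ltnW //; apply: mono => //; by rewrite inE sM.
  - by rewrite ltnn.
(* The colour of t: remove the j-th element of t and evaluate there. *)
pose col (t : seq nat) := [ffun j : 'I_M.+1 => h (rem (nth 0%N t j) t) (x (nth 0%N t j))].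
have [|A [c [AN Asz Ac]]] := N0P col (iota 0 N0); first by rewrite size_iota.
have As : sorted ltn A := subseq_sorted ltn_trans AN (iota_ltn_sorted _ _).
have AN0 z : z \in A -> (z < N0)%N by move/(mem_subseq AN); rewrite mem_iota.
have rankA s q : sorted ltn s -> {subset s <= A} -> size s = M -> q \in A ->
    h s (x q) = if q \in s then b (+) (count (ltn^~ q) s < m.+1)%N
                else c (inord (count (ltn^~ q) s)).
  move=> ss sA sM qA; have sN0 : all (ltn^~ N0) s by apply/allP => z /sA/AN0.
  case: ifP => qs.
    rewrite -index_sorted_ltn // -{1}(nth_index 0%N qs).
    by have [_ ->] := hP s ss sN0 sM; rewrite // -sM index_mem.
  pose t := sort leq (q :: s).
  have us : uniq s by move: ss; rewrite ltn_sorted_uniq_leq => /andP[].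
  have tt : sorted ltn t.
    by rewrite ltn_sorted_uniq_leq sort_uniq /= qs us sort_sorted //; apply: leq_total.
  have qt : q \in t by rewrite mem_sort mem_head.
  have tA : subseq t A.
    apply: sorted_ltn_subseq => // z; rewrite mem_sort inE => /orP[/eqP->//|].
    exact: sA.
  have rt : rem q t = s.
    apply: (irr_sorted_eq ltn_trans ltnn) => //.
      exact: subseq_sorted ltn_trans _ _ (rem_subseq _ _) tt.
    move=> z; rewrite mem_rem_uniq; last by rewrite sort_uniq /= qs.
    by rewrite inE /= mem_sort inE; case: eqP => [->|] //=.
  have iq : index q t = count (ltn^~ q) s.
    by rewrite index_sorted_ltn // (permP (permEl (perm_sort _ _))) /= ltnn.
  have tM : size t = M.+1 by rewrite size_sort /= sM.
  rewrite -(Ac t tA tM) ffunE inordK; last by rewrite ltnS -sM count_size.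
  by rewrite -iq nth_index // rt.
(* Renumber the indices along the homogeneous sequence A. *)
pose a := nth 0%N A.
have aA q : (q < n)%N -> a q \in A by rewrite -Asz; apply: mem_nth.
have a_lt p q : (p < n)%N -> (q < n)%N -> (a p < a q)%N = (p < q)%N.
  move=> pn qn; have mono := sorted_ltn_nth ltn_trans 0%N As.
  have [pq|qp|->] := ltngtP p q.
  - by apply: mono => //; rewrite inE Asz.
  - apply/negbTE; rewrite -leqNgt ltnW //; apply: mono => //; by rewrite inE Asz.
  - by rewrite ltnn.
exists b, (fun k => c (inord k)), (fun s => h (map a s)), (fun q => x (a q)) => s ss sn sM.
have as_sorted : sorted ltn (map a s).
  by apply: homo_sorted_in sn ss => p q pn qn; rewrite /= a_lt.
have asA : {subset map a s <= A} by move=> _ /mapP[q /(allP sn) qn ->]; apply: aA.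
split=> [|q qn].
  by apply: (proj1 (hP _ as_sorted _ _)); rewrite ?size_map //; apply/allP => z /asA/AN0.
rewrite rankA ?size_map ?aA //.
have -> : count (ltn^~ (a q)) (map a s) = count (ltn^~ q) s.
  by rewrite count_map; apply: eq_in_count => p /(allP sn) pn; rewrite /= a_lt.
suff -> : (a q \in map a s) = (q \in s) by [].
apply/mapP/idP => [[p ps aqp]|qs]; last by exists q.
suff -> : q = p by [].
have pn := allP sn _ ps.
by have := a_lt p q pn qn; have := a_lt q p qn pn; rewrite aqp ltnn; lia.
Qed.

Lemma sorted_ltn_cat (s t : seq nat) (k : nat) :
  sorted ltn s -> sorted ltn t -> all (ltn^~ k) s -> all (leq k) t -> sorted ltn (s ++ t).
Proof.
rewrite !(sorted_pairwise ltn_trans) pairwise_cat => -> -> /allP sk /allP kt.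
rewrite !andbT; apply/allrelP => p q /sk pk /kt kq; exact: leq_trans pk kq.
Qed.

Lemma count_ltn_leq (s : seq nat) q : uniq s -> (count (ltn^~ q) s <= q)%N.
Proof.
move=> us; rewrite -size_filter -{2}(size_iota 0 q) uniq_leq_size ?filter_uniq //.
by move=> z; rewrite mem_filter mem_iota => /andP[].
Qed.

(** Either the values v of [rank_function] change at some rank j, and moving the
    element of rank j over a long gap gives thresholds in H; or they are constant,
    and h s is the indicator, up to negation, of the lower or of the upper half of
    s.  Adding to a set B of at most m + 1 points enough later (or earlier) points
    puts B into the lower (or upper) half, so that every B is cut out. *)
Lemma rank_dichotomy (X : Type) (H G : set (X -> bool)) (m l : nat) :
  (forall s t, size s = (m.+1 + m.+1)%N -> G t -> exists2 h, H h & map h s = map t s) ->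
  exists N, littlestone_shatters G N ->
    VC_shatters H m.+1 \/ littlestone_shatters H l.
Proof.
move=> agr; have [w wP] := threshold_littlestone X l.
set M := (m.+1 + m.+1)%N in agr *.
have [N NP] := rank_function (M + w + m.+1) agr; exists N.
move=> {agr NP} /NP[b [v [h [x hP]]]].
have [[j jM vj]|const] := pselect (exists2 j, (j < M)%N & v j.+1 = ~~ v j).
  (* The element j + p moves inside the gap from j to j + w. *)
  right; pose s p := iota 0 j ++ (j + p)%N :: iota (j + w) (M - j.+1).
  have sP p : (p < w)%N -> [/\ sorted ltn (s p), all (ltn^~ (M + w + m.+1)%N) (s p)
                             & size (s p) = M].
    move=> pw; split.
    - apply: (@sorted_ltn_cat _ _ j); rewrite ?iota_ltn_sorted //.
      + apply: (@sorted_ltn_cat [:: (j + p)%N] _ (j + p).+1) => //=.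
        * exact: iota_ltn_sorted.
        * by rewrite ltnSn.
        * by apply/allP => z; rewrite mem_iota /=; lia.
      + by apply/allP => z; rewrite mem_iota add0n.
      + by rewrite /= leq_addr; apply/allP => z; rewrite mem_iota /=; lia.
    - by apply/allP => z; rewrite mem_cat inE !mem_iota /=; lia.
    - by rewrite size_cat /= !size_iota; lia.
  apply: (wP H (fun p => h (s p)) (fun q => x (j + q)%N) (v j)) => [p|p q] pw.
    by have [s1 s2 s3] := sP p pw; have [] := hP _ s1 s2 s3.
  move=> qw pq; have [s1 s2 s3] := sP p pw; have [_ ->] := hP _ s1 s2 s3; last by lia.
  rewrite mem_cat inE !mem_iota eqn_add2l; case: ifP => [|_]; first by lia.
  have -> : count (ltn^~ (j + q)%N) (s p) = (j + (p < q))%N.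
    rewrite count_cat /= ltn_add2l; congr addn.
      rewrite -[RHS](size_iota 0 j); apply/eqP; rewrite -all_count.
      by apply/allP => z; rewrite mem_iota /=; lia.
    rewrite -[RHS]addn0; congr addn; apply/eqP; rewrite -leqn0 leqNgt -has_count.
    by apply/hasPn => z; rewrite mem_iota /=; lia.
  by case: (p < q)%N; rewrite ?addn1 ?addn0 ?vj ?addbT ?addbF.
left; have {const} vE j : (j <= M)%N -> v j = v 0%N.
  elim: j => // j IH jM; rewrite -IH; last exact: ltnW.
  have [->//|ne] := eqVneq (v j.+1) (v j).
  by case: const; exists j => //; case: (v j.+1) (v j) ne => [] [].
have rank0 s q : (size s = M)%N -> v (count (ltn^~ q) s) = v 0%N.
  by move=> sM; rewrite vE // -sM count_size.
have [vb|vb] := eqVneq (v 0%N) b.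
(* Off s the value is b: only the lower half of s is singled out. *)
- apply: (@VC_shattersP _ _ _ (fun i : 'I_m.+1 => x i)) => y.
  pose B := [seq i <- iota 0 m.+1 | y (inord i) != b].
  have BM : (size B <= m.+1)%N by rewrite size_filter -{2}(size_iota 0 m.+1) count_size.
  pose s := B ++ iota m.+1 (M - size B).
  have s1 : sorted ltn s.
    apply: (@sorted_ltn_cat _ _ m.+1); rewrite ?iota_ltn_sorted //.
    + exact/sorted_filter/iota_ltn_sorted/ltn_trans.
    + by apply/allP => z; rewrite mem_filter mem_iota => /andP[].
    + by apply/allP => z; rewrite mem_iota => /andP[].
  have s2 : all (ltn^~ (M + w + m.+1)%N) s.
    by apply/allP => z; rewrite mem_cat mem_filter !mem_iota /=; lia.
  have s3 : size s = M by rewrite size_cat size_iota; lia.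
  have [Hs sE] := hP s s1 s2 s3; exists (h s) => // i.
  have im := ltn_ord i; rewrite sE; last by lia.
  rewrite rank0 // vb mem_cat mem_filter !mem_iota inord_val.
  have -> : (count (ltn^~ (i : nat)) s < m.+1)%N.
    by rewrite (leq_ltn_trans _ im) // count_ltn_leq //; apply: sorted_uniq s1;
      [apply: ltn_trans|apply: ltnn].
  have -> : (m < i)%N = false by lia.
  by rewrite im /= andbT orbF addbT; case: (y i) (b) => [] [].
(* Off s the value is ~~ b: only the upper half of s is singled out. *)
- apply: (@VC_shattersP _ _ _ (fun i : 'I_m.+1 => x (M + i)%N)) => y.
  pose B := [seq i <- iota M m.+1 | y (inord (i - M)) == b].
  have BM : (size B <= m.+1)%N by rewrite size_filter -{2}(size_iota M m.+1) count_size.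
  pose s := iota 0 (M - size B) ++ B.
  have s1 : sorted ltn s.
    apply: (@sorted_ltn_cat _ _ M); rewrite ?iota_ltn_sorted //.
    + exact/sorted_filter/iota_ltn_sorted/ltn_trans.
    + by apply/allP => z; rewrite mem_iota /=; lia.
    + by apply/allP => z; rewrite mem_filter mem_iota => /andP[_ /andP[]].
  have s2 : all (ltn^~ (M + w + m.+1)%N) s.
    by apply/allP => z; rewrite mem_cat mem_filter !mem_iota /=; lia.
  have s3 : size s = M by rewrite size_cat size_iota; lia.
  have [Hs sE] := hP s s1 s2 s3; exists (h s) => // i.
  have im := ltn_ord i; rewrite sE; last by lia.
  rewrite rank0 // mem_cat mem_filter !mem_iota addKn inord_val.
  have -> : (count (ltn^~ (M + i)%N) s < m.+1)%N = false.
    apply/negbTE; rewrite -leqNgt count_cat (@leq_trans (M - size B)) ?leq_subRL //; try lia.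
    rewrite (leq_trans _ (leq_addr _ _)) //.
    rewrite -{1}(size_iota 0 (M - size B)) -(count_predT) eq_leq //.
    by apply: eq_in_count => z; rewrite mem_iota /=; lia.
  have -> : (M + i < 0 + (M - size B))%N = false by lia.
  have -> : (M <= M + i < M + m.+1)%N by lia.
  by rewrite andbF /= andbT addbF; move: vb; case: (y i) (v 0%N) (b) => [] [] [].
Qed.

Lemma Ldim_saturation_finite (R : realType) (X : Type) (H : set (X -> bool))
    l d (eps : R) :
  Ldim H = Some l -> VC H = Some d -> (d.+1 + d.+1)%:R * eps <= 1 ->
  Ldim (saturation_infty H eps) <> infty.
Proof.
move=> /greatestP[Hl lmax] /greatestP[_ dmax] deps.
have [N NP] : exists N, littlestone_shatters (saturation_infty H eps) N ->
    VC_shatters H d.+1 \/ littlestone_shatters H l.+1.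
  by apply: rank_dichotomy => s t sz; apply: saturation_agree; rewrite sz.
have bound n : littlestone_shatters (saturation_infty H eps) n -> (n <= N)%N.
  move=> sh; rewrite leqNgt; apply/negP => Nn.
  case: (NP (littlestone_le (ltnW Nn) sh)) => [/dmax|/lmax]; by rewrite ltnn.
have [m] := greatest_bounded (littlestone_sub (@sub_saturation _ _ H eps) Hl) bound.
by rewrite /Ldim => ->.
Qed.

(** * Saturation by one-point deletions *)

(** Each of the n deletions has weight 1 / n and misses only its own point of s, so
    at most the weight 1 / n < eps errs at any given point. *)
Lemma saturation_deletions (R : realType) (X : eqType) (H : set (X -> bool))
    (eps : R) (k n : nat) (s : seq X) (x0 : X) :
  (0 < n <= size s)%N -> uniq s -> n%:R^-1 < eps ->
  (forall i, (i < n)%N -> saturation H eps k (fun x => x \in rem (nth x0 s i) s)) ->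
  saturation H eps k.+1 (fun x => x \in s).
Proof.
move=> /andP[n0 ns] us neps Hdel; right.
pose F := @WeightedFamily R X n (fun i x => x \in rem (nth x0 s i) s) (fun=> n%:R^-1).
have n0R : 0 < n%:R :> R by rewrite ltr0n.
have si (i : 'I_n) : nth x0 s i \in s by rewrite mem_nth // (leq_trans _ ns).
have thr : is_threshold eps F (fun x => x \in s).
  move=> x; rewrite /disagreement /=; apply: le_lt_trans neps.
  have [xs|xs] /= := boolP (x \in s); last first.
    rewrite big1 ?invr_ge0 ?ltW // => i; rewrite mem_rem_uniq // inE /=.
    by rewrite (negPf xs) andbF.
  rewrite (eq_bigl (fun i : 'I_n => i == index x s :> nat)); last first.
    move=> i; rewrite mem_rem_uniq // inE /= xs andbT eqbF_neg negbK.
    have iS : (i < size s)%N by rewrite (leq_trans _ ns).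
    by rewrite -{1}(nth_index x0 xs) nth_uniq // ?index_mem // eq_sym.
  have [ix|ix] := ltnP (index x s) n; first by rewrite (big_pred1 (Ordinal ix)).
  rewrite big_pred0 ?invr_ge0 ?ltW // => i.
  by apply/negP => /eqP E; move: (ltn_ord i); rewrite E ltnNge ix.
exists F => //; split=> /=.
- by move=> i; apply: Hdel.
- move=> i j /(congr1 (fun f => f (nth x0 s j))); rewrite !mem_rem_uniq // !inE /= eqxx.
  rewrite si andbT => /negbFE; rewrite nth_uniq ?(leq_trans _ ns) // => /eqP ji.
  exact/val_inj.
- by move=> i; rewrite invr_gt0 n0R invf_le1 // ler1n.
- by rewrite sumr_const card_ord -[LHS]mulr_natr mulVf // gt_eqF.
- by move=> x; exists (x \in s).
Qed.

Definition small_sets (d : nat) : set (nat -> bool) :=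
  [set h | exists s : seq nat, [/\ uniq s, (size s <= d)%N & h = (fun x => x \in s)]]%classic.

(** A set of size d + n + 1 is the threshold of d + 1 of its one-point deletions,
    so each step of the saturation increases the admissible size by one. *)
Lemma small_sets_saturation (R : realType) (d : nat) (eps : R) n (s : seq nat) :
  1 / (d + 1)%:R < eps -> uniq s -> (size s <= d + n)%N ->
  saturation (small_sets d) eps n (fun x => x \in s).
Proof.
move=> deps; elim: n s => [|n IH] s us sz.
  by exists s; split=> //; rewrite addn0 in sz.
have [small|big] := leqP (size s) (d + n); first by left; apply: IH.
apply: (@saturation_deletions _ _ _ _ _ d.+1 _ 0%N) => //.
- by rewrite /= (leq_trans _ big) // ltnS leq_addr.
- by rewrite -div1r -addn1.
move=> i id; apply: IH; first exact: rem_uniq.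
have iS : (i < size s)%N by lia.
by rewrite size_rem ?mem_nth // -subn1 leq_subLR add1n -addnS.
Qed.

Lemma nat_VC_shatters (H : set (nat -> bool)) m :
  (forall s, uniq s -> (size s <= m)%N -> H (fun x => x \in s)) -> VC_shatters H m.
Proof.
move=> Hs; apply: (@VC_shattersP _ _ _ (@nat_of_ord m)) => y.
exists (fun x => x \in [seq nat_of_ord i | i <- enum 'I_m & y i]).
  apply: Hs; first by rewrite (map_inj_uniq (@ord_inj m)) filter_uniq // enum_uniq.
  by rewrite size_map size_filter (leq_trans (count_size _ _)) // size_enum_ord.
by move=> i; rewrite (mem_map (@ord_inj m)) mem_filter mem_enum andbT.
Qed.

Lemma infinite_saturation (R : realType) (d : nat) (eps : R) :
  1 / (d + 1)%:R < eps ->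
  exists (X : Type) (H : set (X -> bool)),
    [/\ Ldim H <> infty, VC H = Some d, Ldim (saturation_infty H eps) = infty
      & VC (saturation_infty H eps) = infty].
Proof.
move=> deps; exists nat, (small_sets d).
have VCd : VC_shatters (small_sets d) d.
  by apply: nat_VC_shatters => s us sd; exists s.
have Ld m : littlestone_shatters (small_sets d) m -> (m <= d)%N.
  by apply: littlestone_support => g [s [_ sd ->]]; exists s.
have VCinf m : VC_shatters (saturation_infty (small_sets d) eps) m.
  apply: nat_VC_shatters => s us sm; exists m => //.
  by apply: small_sets_saturation => //; rewrite (leq_trans sm) ?leq_addl.
split.
- by have [m] := greatest_bounded (VC_littlestone VCd) Ld; rewrite /Ldim => ->.
- by apply/greatestP; split=> // n /VC_littlestone/Ld.
- by apply: greatest_infty => m; apply: VC_littlestone.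
- exact: greatest_infty.
Qed.

(** * A class of small VC dimension whose saturation has larger Ldim *)

(** The empty prefix is left out: it would lie on every chain, so that querying it
    would not help to shatter a tree. *)
Definition prefixes (y : seq nat) : seq (seq nat) := [seq take i.+1 y | i <- iota 0 (size y)].

Lemma mem_prefixes x y : (x \in prefixes y) = (x != [::]) && prefix x y.
Proof.
apply/mapP/andP => [[i]|[x0 xy]].
  rewrite mem_iota add0n => /= iy ->; split; last exact: prefix_take.
  by rewrite -size_eq0 size_takel.
exists (size x).-1; last by rewrite prednK ?lt0n ?size_eq0 //; apply/eqP; rewrite eq_sym -prefixE.
by rewrite mem_iota add0n prednK ?lt0n ?size_eq0 // size_prefix.
Qed.

Lemma size_prefixes y : size (prefixes y) = size y.
Proof. by rewrite size_map size_iota. Qed.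

Lemma uniq_prefixes y : uniq (prefixes y).
Proof.
rewrite map_inj_in_uniq ?iota_uniq // => i j; rewrite !mem_iota !add0n /= => iy jy.
by move/(congr1 size); rewrite !size_takel // => -[].
Qed.

Definition punctured_chains (m : nat) : set (seq nat -> bool) :=
  [set h | exists (y z : seq nat), [/\ size y = m, z \in prefixes y
     & h = (fun x => x \in rem z (prefixes y))]]%classic.

Lemma punctured_chains_littlestone m n :
  littlestone_shatters (punctured_chains m) n -> (n <= m.-1)%N.
Proof.
apply: littlestone_support => g [y [z [sy zy ->]]]; exists (rem z (prefixes y)) => //.
by rewrite size_rem // size_prefixes sy.
Qed.

(** Three shattered points lie on a common chain.  A member that contains only the
    longest of them comes from a chain that contains all three, hence lacks two
    points of this chain instead of one. *)
Lemma punctured_chains_VC m n : VC_shatters (punctured_chains m) n -> (n <= 2)%N.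
Proof.
rewrite leqNgt => sh; apply/negP => n3; move: sh => [x [injx real]].
have chain i j y : x i \in prefixes y -> x j \in prefixes y ->
    (size (x i) <= size (x j))%N -> prefix (x i) (x j).
  rewrite !mem_prefixes => /andP[_ /prefixP[u yu]] /andP[_ /prefixP[v yv]] ij.
  apply/prefixP; exists (drop (size (x i)) (x j)).
  rewrite -{1}(take_size_cat u (erefl (size (x i)))) -yu yv take_cat.
  case: ltngtP ij => // [_|->] _; rewrite ?cat_take_drop //.
  by rewrite subnn take0 cats0 drop_size cats0.
have [_ [y [z [_ _ ->]]] ally] := real (fun=> true).
have {ally} xy i : x i \in prefixes y by have := mem_rem (ally i).
pose top := [arg max_(i > Ordinal n3) size (x i)].
have topP i : (size (x i) <= size (x top))%N.
  by rewrite /top; case: arg_maxnP => // j _ /(_ i isT).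
have [_ [y' [z' [_ _ ->]]] only_top] := real (fun i => i == top).
have below i : i != top -> x i = z'.
  move=> itop; have := only_top i; rewrite (negPf itop).
  rewrite mem_rem_uniq ?uniq_prefixes // inE /=.
  suff -> : x i \in prefixes y' by rewrite andbT => /negbFE/eqP.
  have := mem_rem (etrans (only_top top) (eqxx _)).
  rewrite !mem_prefixes => /andP[_]; move: (xy i); rewrite mem_prefixes => /andP[-> _].
  exact/prefix_trans/(chain _ _ y).
have two : (2 <= #|predC1 top|)%N by rewrite cardC1 card_ord; lia.
have /card_gt1P[i [j [it jt ij]]] := two.
by move/eqP: ij; apply; apply: injx; rewrite !below.
Qed.

Lemma punctured_chains_VC1 m : (2 <= m)%N -> VC_shatters (punctured_chains m) 1.
Proof.
move=> m2; apply: (@VC_shattersP _ _ _ (fun=> [:: 0%N])) => y.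
pose w := nseq m 0%N.
exists (fun x => x \in rem (nseq (if y ord0 then 2 else 1)%N 0%N) (prefixes w)).
  exists w, (nseq (if y ord0 then 2 else 1)%N 0%N); split=> //; first by rewrite size_nseq.
  rewrite mem_prefixes {}/w; case: m m2 => [|[|m]] // _.
  by case: (y ord0); rewrite /= ?prefix0s.
move=> i; have -> : i = ord0 by apply: ord1.
rewrite mem_rem_uniq ?uniq_prefixes // inE /= mem_prefixes.
rewrite {}/w; case: m m2 => [|[|m]] // _; case: (y ord0) => /=; by rewrite ?prefix0s ?andbT.
Qed.

(** The query of the child [rcons p a] of p either moves to that child, or excludes
    it, after which the next child is tried: there are infinitely many of them, so
    each answer costs one level only.  Here p is the known part of the word, and
    its next letter is known to be at least a. *)
Lemma splits_chains m k (p : seq nat) (a : nat) (G : set (seq nat -> bool)) :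
  (size p + k <= m)%N ->
  (forall y, size y = m -> prefix p y -> (a <= nth a y (size p))%N ->
     G (fun x => x \in prefixes y)) ->
  splits setT k G.
Proof.
elim: k p a G => [|k IH] p a G pk Gp /=.
  rewrite addn0 in pk.
  exists (fun x => x \in prefixes (p ++ nseq (m - size p) a)); apply: Gp.
  - by rewrite size_cat size_nseq subnKC.
  - exact: prefix_prefix.
  - by rewrite nth_cat ltnn subnn nth_nseq if_same.
exists (rcons p a) => // -[].
- apply: (IH (rcons p a) 0%N); first by rewrite size_rcons addSnnS.
  move=> y sy py _; split; last by rewrite mem_prefixes py -size_eq0 size_rcons.
  apply: Gp => //; first by apply: prefix_trans py; apply: prefix_rcons.
  case/prefixP: py => u ->; rewrite cat_rcons nth_cat ltnn subnn /=.
  exact: leqnn.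
- apply: (IH p a.+1); first by rewrite (leq_trans _ pk) // leq_add2l.
  move=> y sy py ay.
  have ay' : (a < nth a y (size p))%N.
    by rewrite (set_nth_default a.+1) // sy (leq_trans _ pk) // addnS ltnS leq_addr.
  split; first by apply: Gp => //; apply: ltnW.
  rewrite mem_prefixes; apply/negbTE/negP => /andP[_ /prefixP[u yE]].
  by move: ay'; rewrite yE cat_rcons nth_cat ltnn subnn ltnn.
Qed.

Lemma punctured_chains_saturation (R : realType) m (eps : R) :
  (0 < m)%N -> m%:R^-1 < eps ->
  littlestone_shatters (saturation_infty (punctured_chains m) eps) m.
Proof.
move=> m0 meps; apply/littlestone_splits.
apply: (@splits_chains m m [::] 0%N) => // y sy _ _; exists 1%N => //.
apply: (@saturation_deletions _ _ _ _ _ m _ [::]) => //.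
- by rewrite m0 size_prefixes sy /=.
- exact: uniq_prefixes.
move=> i im; exists y, (nth [::] (prefixes y) i); split=> //.
by rewrite mem_nth // size_prefixes sy.
Qed.

(** The length 26 is such that 1 / 26 < eps is compatible with eps < 1 / (2 C):
    the VC dimension is at most 2 and 2 C is less than 25 + 1 / 2. *)
Lemma Ldim_saturation_neq (R : realType) (C : R) : 12 <= C < 12 + 1 / 2 ->
  exists (X : Type) (H : set (X -> bool)) (l d : nat) (eps : R),
    [/\ Ldim H = Some l /\ VC H = Some d, 0 < eps < 1 / 2, (1 <= d)%N,
        eps < 1 / (C * d%:R) & Ldim (saturation_infty H eps) <> Ldim H].
Proof.
move=> /andP[C1 C2].
pose H := punctured_chains 26.
have VC1 : VC_shatters H 1 by apply: punctured_chains_VC1.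
have [d VCd /andP[d1 d2]] := greatest_bounded VC1 (@punctured_chains_VC _).
have [l Ll /andP[_ l25]] :=
  greatest_bounded (VC_littlestone VC1) (@punctured_chains_littlestone _).
pose eps : R := 2 / 51.
exists (seq nat), H, l, d, eps; split=> //.
- by apply/andP; split; rewrite /eps; lra.
- have dR : 1 <= (d%:R : R) <= 2 by rewrite ler1n ler_nat d1.
  have Cd : 0 < C * d%:R < 25 + 1 / 2.
    by case/andP: dR => *; apply/andP; split; nra.
  by case/andP: Cd => *; rewrite ltr_pdivlMr // /eps; lra.
rewrite /Ldim Ll => /greatestP[_ lmax].
have eps26 : 26%:R^-1 < eps by rewrite /eps; lra.
have le26 : (26 <= l)%N by apply: lmax; apply: punctured_chains_saturation eps26.
by have := leq_trans le26 l25.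
Qed.

(** * The theorem *)

Theorem theorem8p1 (R : realType) :
  [/\ (* (a) *)
      forall (X : Type) (H : set (X -> bool)) (l d : nat) (eps : R),
        Ldim H = Some l -> VC H = Some d -> 0 < eps < 1 / 2 ->
        eps <= 1 / (l + 1)%:R ->
        Ldim (saturation_infty H eps) = Ldim H /\ Ldim H = Some l,
      (* (b) *)
      forall (X : Type) (H : set (X -> bool)) (l d : nat) (eps : R),
        Ldim H = Some l -> VC H = Some d -> 0 < eps < 1 / 2 ->
        eps <= 1 / (d + 1)%:R ->
        VC (saturation_infty H eps) = VC H /\ VC H = Some d,
      (* (c), with 12.0412 <= C < 12.0413 *)
      exists C : R,
        [/\ 12 + 412 / 10 ^+ 4 <= C < 12 + 413 / 10 ^+ 4,
            forall (X : Type) (H : set (X -> bool)) (l d : nat) (eps : R),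
              Ldim H = Some l -> VC H = Some d -> 0 < eps < 1 / 2 ->
              (1 <= d)%N -> eps < 1 / (C * d%:R) ->
              Ldim (saturation_infty H eps) <> infty
          & exists (X : Type) (H : set (X -> bool)) (l d : nat) (eps : R),
              [/\ Ldim H = Some l /\ VC H = Some d,
                  0 < eps < 1 / 2,
                  (1 <= d)%N,
                  eps < 1 / (C * d%:R)
                & Ldim (saturation_infty H eps) <> Ldim H]]
    & (* (d) *)
      forall (d : nat) (eps : R),
        (1 <= d)%N -> 1 / (d + 1)%:R < eps < 1 / 2 ->
        exists (X : Type) (H : set (X -> bool)),
          [/\ Ldim H <> infty,
              VC H = Some d,
              Ldim (saturation_infty H eps) = infty
            & VC (saturation_infty H eps) = infty]].
Proof.
split.
- move=> X H l d eps Hl _ _ leps; split=> //.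
  by rewrite Hl; apply: Ldim_saturation.
- move=> X H l d eps _ Hd _ deps; split=> //.
  by rewrite Hd; apply: VC_saturation.
- exists (12 + 412 / 10 ^+ 4); split.
  + by apply/andP; split; lra.
  + move=> X H l d eps Hl Hd /andP[eps0 _] d1 deps.
    apply: Ldim_saturation_finite Hl Hd _.
    (* 2 (d + 1) <= 4 d <= C d *)
    have dR : 1 <= (d%:R : R) by rewrite ler1n.
    have Cd : 0 < (12 + 412 / 10 ^+ 4) * (d%:R : R) by nra.
    rewrite ltr_pdivlMr // in deps.
    rewrite natrD -natr1; nra.
  + by apply: Ldim_saturation_neq; apply/andP; split; lra.
- by move=> d eps _ /andP[deps _]; apply: infinite_saturation.
Qed.
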